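(* Let $G$ be a finite simple graph that contains none of $P_2+P_3$, $\overline{P_2+P_3}$, $K_2+K_3$, co-banner as an induced subgraph, and suppose $G$ contains an induced $\overline{H_2}$. Then the complement graph $\overline{G}$ is a good graph.
   Context: $P_2+P_3$ is the disjoint union of a two-vertex path and a three-vertex path, $\overline{P_2+P_3}$ its complement; $K_2+K_3$ is the disjoint union of an edge and a triangle. A banner is a chordless 4-cycle plus one vertex adjacent to exactly one vertex of the cycle; a co-banner is its complement. $\overline{H_2}$ is the 6-vertex graph with vertices $v_1,v_2,v_3,v_4,b_1,b_2$ and edges $v_1v_2,v_2v_3,v_3v_4,v_4v_1,b_1v_1,b_1v_2,b_2v_2,b_2v_3,b_1b_2$ and no others. $\chi$, $\omega$ denote chromatic and clique number, $N(v)$ the neighbourhood and $d(v)=|N(v)|$. Two vertices are comparable if they are nonadjacent and the neighbourhood of one is contained in that of the other. A universal vertex is adjacent to all other vertices. A vertex $v$ of a graph $F$ is nice if $d(v)\leq\omega(F)+2$. $F$ is nice if it has three pairwise disjoint stable sets $S_1,S_2,S_3$ with $\omega(F-(S_1\cup S_2\cup S_3))\leq\omega(F)-2$. $F$ is good if at least one holds: (a) $F$ has a pair of comparable vertices; (b) $F$ has a universal vertex; (c) $F$ has a nice vertex; (d) $F$ is nice; (e) $\chi(F)\leq\omega(F)+3$. *)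

(* Defs.v *)
From mathcomp Require Export all_boot.

Set Implicit Arguments.
Unset Strict Implicit.
Unset Printing Implicit Defensive.

Record sgraph := SGraph {
  vertex :> finType;
  adj : rel vertex;
  adj_sym : symmetric adj;
  adj_irr : irreflexive adj
}.

Definition compl_adj (G : sgraph) : rel G := fun x y => (x != y) && ~~ adj x y.

Fact compl_adj_sym (G : sgraph) : symmetric (@compl_adj G).
Proof. by move=> x y; rewrite /compl_adj eq_sym adj_sym. Qed.

Fact compl_adj_irr (G : sgraph) : irreflexive (@compl_adj G).
Proof. by move=> x; rewrite /compl_adj eqxx. Qed.

Definition compl (G : sgraph) : sgraph :=
  SGraph (@compl_adj_sym G) (@compl_adj_irr G).

Definition disj_adj (G H : sgraph) : rel (G + H)%type := fun u v =>
  match u, v with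
  | inl x, inl y => adj x y
  | inr x, inr y => adj x y
  | _, _ => false
  end.

Fact disj_adj_sym (G H : sgraph) : symmetric (@disj_adj G H).
Proof. by move=> [x|x] [y|y] //=; rewrite adj_sym. Qed.

Fact disj_adj_irr (G H : sgraph) : irreflexive (@disj_adj G H).
Proof. by move=> [x|x] /=; rewrite adj_irr. Qed.

Definition disj_union (G H : sgraph) : sgraph :=
  SGraph (@disj_adj_sym G H) (@disj_adj_irr G H).

Definition induced_adj (G : sgraph) (A : {set G}) : rel {x : G | x \in A} :=
  fun x y => adj (val x) (val y).

Fact induced_adj_sym (G : sgraph) (A : {set G}) : symmetric (induced_adj (A := A)).
Proof. by move=> x y; rewrite /induced_adj adj_sym. Qed.

Fact induced_adj_irr (G : sgraph) (A : {set G}) :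
  irreflexive (induced_adj (A := A)).
Proof. by move=> x; rewrite /induced_adj adj_irr. Qed.

Definition induced (G : sgraph) (A : {set G}) : sgraph :=
  SGraph (@induced_adj_sym G A) (@induced_adj_irr G A).

Definition del_vertices (G : sgraph) (A : {set G}) : sgraph := induced (~: A).

(* The graph on {0, ..., n-1} whose edges are the unordered pairs listed in s;
   loops in s are ignored. *)
Definition edges_adj (n : nat) (s : seq (nat * nat)) : rel 'I_n :=
  fun i j => (i != j) &&
    (((i : nat, j : nat) \in s) || ((j : nat, i : nat) \in s)).

Fact edges_adj_sym n s : symmetric (@edges_adj n s).
Proof. by move=> i j; rewrite /edges_adj eq_sym orbC. Qed.

Fact edges_adj_irr n s : irreflexive (@edges_adj n s).
Proof. by move=> i; rewrite /edges_adj eqxx. Qed.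

Definition edges_graph (n : nat) (s : seq (nat * nat)) : sgraph :=
  SGraph (@edges_adj_sym n s) (@edges_adj_irr n s).

Definition path_graph (n : nat) : sgraph :=
  edges_graph n [seq (i, i.+1) | i <- iota 0 n.-1].

Definition complete_graph (n : nat) : sgraph := compl (edges_graph n [::]).

Definition P2_P3 : sgraph := disj_union (path_graph 2) (path_graph 3).

Definition K2_K3 : sgraph := disj_union (complete_graph 2) (complete_graph 3).

(* 4-cycle 0-1-2-3 with the pendant vertex 4 attached to 0. *)
Definition banner : sgraph :=
  edges_graph 5 [:: (0, 1); (1, 2); (2, 3); (3, 0); (4, 0)].

Definition co_banner : sgraph := compl banner.

(* v_1, ..., v_4, b_1, b_2 are numbered 0, 1, 2, 3, 4, 5. *)
Definition H2bar : sgraph :=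
  edges_graph 6 [:: (0, 1); (1, 2); (2, 3); (3, 0);
                    (4, 0); (4, 1); (5, 1); (5, 2); (4, 5)].

Definition contains_induced (G H : sgraph) : Prop :=
  exists f : H -> G, injective f /\ forall x y : H, adj (f x) (f y) = adj x y.

Definition nbh (G : sgraph) (v : G) : {set G} := [set u | adj v u].

Definition deg (G : sgraph) (v : G) : nat := #|nbh v|.

Definition clique (G : sgraph) (A : {set G}) : bool :=
  [forall x in A, forall y in A, (x != y) ==> adj x y].

Definition stable (G : sgraph) (A : {set G}) : bool :=
  [forall x in A, forall y in A, ~~ adj x y].

Definition omega (G : sgraph) : nat := \max_(A : {set G} | clique A) #|A|.

Definition colorable (G : sgraph) (k : nat) : bool :=
  [exists c : {ffun G -> 'I_k}, forall x, forall y, adj x y ==> (c x != c y)].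

Fact colorable_exists (G : sgraph) : exists k, colorable G k.
Proof.
exists #|G|; apply/existsP; exists [ffun x => enum_rank x].
apply/forallP => x; apply/forallP => y; apply/implyP => xy.
by rewrite !ffunE (inj_eq enum_rank_inj); apply: contraTneq xy => ->;
  rewrite adj_irr.
Qed.

Definition chi (G : sgraph) : nat := ex_minn (colorable_exists G).

(* Distinctness is needed: a vertex is nonadjacent to itself. *)
Definition comparable_vertices (G : sgraph) (u v : G) : Prop :=
  [/\ u != v, ~~ adj u v & nbh u \subset nbh v \/ nbh v \subset nbh u].

Definition universal_vertex (G : sgraph) (v : G) : Prop :=
  forall u : G, u != v -> adj v u.

Definition nice_vertex (G : sgraph) (v : G) : Prop := deg v <= omega G + 2.

(* The bound omega(G - S) <= omega(G) - 2 is written additively because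
   subtraction on nat is truncated. *)
Definition nice_graph (G : sgraph) : Prop :=
  exists S1 S2 S3 : {set G},
    [/\ stable S1, stable S2 & stable S3] /\
    [/\ [disjoint S1 & S2], [disjoint S1 & S3] & [disjoint S2 & S3]] /\
    omega (del_vertices (S1 :|: S2 :|: S3)) + 2 <= omega G.

Definition good (G : sgraph) : Prop :=
  (exists u v : G, comparable_vertices u v) \/
  (exists v : G, universal_vertex v) \/
  (exists v : G, nice_vertex v) \/
  nice_graph G \/
  chi G <= omega G + 3.

(* Main.v *)
(** Write v1, ..., v4, b1, b2 for the vertices of an induced [H2bar]; then v2 is
    a nice vertex of the complement.  Let U be the set of nonneighbours of v2
    that are adjacent to all of v4, b1, b2.  The neighbourhood on [H2bar] of a
    nonneighbour of v2 outside U is empty, {v1, v3}, {b1} or {b2} (v4 itself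
    falls under the second case), and two such vertices are never adjacent; so
    together with v2 they form a clique of the complement.  Moreover adjacency
    to v1 separates the elements of U, so U has at most two of them. *)
Require Import Defs.

(* Two images coincide only if all their adjacencies do, so each coincidence is
   refuted by two of the adjacencies in the context. *)
Ltac by_adjacency :=
  match goal with
  | |- ?a = ?a -> _ =>
      by move=> _; do ?congr inl; do ?congr inr; apply: val_inj
  | |- _ = _ -> _ => move=> ?; subst; exfalso;
      match goal with
      | H : ?t = true, H' : ?t = false |- _ => by rewrite H in H'
      | H : _ <> _ |- _ => exact: H
      end
  | |- _ = _ => by rewrite /compl_adj /= -?val_eqE
  end.

(** Both orientations are kept, as equations with a boolean, so that a clash is found by matching
    after [subst]. *)
Ltac intro_adjacencies :=
  repeat (case/andP => /[dup] ? /[1! adj_sym] ?);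
  move=> /[dup] ? /[1! adj_sym] ?;
  repeat match goal with
  | H : is_true (~~ _) |- _ => move/negbTE in H
  | H : is_true (adj _ _) |- _ => rewrite /is_true in H
  end.

(** The path ends [c], [e] have the same neighbours, so no adjacency separates them and distinctness
    must be assumed. *)
Lemma no_P2_P3 {G : sgraph} (a b c d e : G) :
  ~ contains_induced G P2_P3 -> c != e ->
  ~~ [&& adj a b, adj c d, adj d e, ~~ adj c e,
         ~~ adj a c, ~~ adj a d, ~~ adj a e,
         ~~ adj b c, ~~ adj b d & ~~ adj b e].
Proof.
have := (adj_irr a, adj_irr b, adj_irr c, adj_irr d, adj_irr e).
move=> [[[[? ?] ?] ?] ?] nI /eqP ce.
apply/negP => adjs; apply: nI; move: adjs; intro_adjacencies.
exists (fun u : P2_P3 => match u with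
  | inl i => nth a [:: a; b] i | inr i => nth a [:: c; d; e] i end).
by split=> - [[[|[|[]]] //= ?]|[[|[|[|[]]]] //= ?]]
  [[[|[|[]]] //= ?]|[[|[|[|[]]]] //= ?]] //=; by_adjacency.
Qed.

(** Here [a] and [b] are the pair that adjacencies cannot separate. *)
Lemma no_compl_P2_P3 {G : sgraph} (a b c d e : G) :
  ~ contains_induced G (compl P2_P3) -> a != b ->
  ~~ [&& ~~ adj a b, adj c e, ~~ adj c d, ~~ adj d e,
         adj a c, adj a d, adj a e, adj b c, adj b d & adj b e].
Proof.
have := (adj_irr a, adj_irr b, adj_irr c, adj_irr d, adj_irr e).
move=> [[[[? ?] ?] ?] ?] nI /eqP ab.
apply/negP => adjs; apply: nI; move: adjs; intro_adjacencies.
exists (fun u : compl P2_P3 => match u with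
  | inl i => nth a [:: a; b] i | inr i => nth a [:: c; d; e] i end).
by split=> - [[[|[|[]]] //= ?]|[[|[|[|[]]]] //= ?]]
  [[[|[|[]]] //= ?]|[[|[|[|[]]]] //= ?]] //=; by_adjacency.
Qed.

Lemma no_K2_K3 {G : sgraph} (a b c d e : G) :
  ~ contains_induced G K2_K3 ->
  ~~ [&& adj a b, adj c d, adj d e, adj c e,
         ~~ adj a c, ~~ adj a d, ~~ adj a e,
         ~~ adj b c, ~~ adj b d & ~~ adj b e].
Proof.
have := (adj_irr a, adj_irr b, adj_irr c, adj_irr d, adj_irr e).
move=> [[[[? ?] ?] ?] ?] nI.
apply/negP => adjs; apply: nI; move: adjs; intro_adjacencies.
exists (fun u : K2_K3 => match u with
  | inl i => nth a [:: a; b] i | inr i => nth a [:: c; d; e] i end).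
by split=> - [[[|[|[]]] //= ?]|[[|[|[|[]]]] //= ?]]
  [[[|[|[]]] //= ?]|[[|[|[|[]]]] //= ?]] //=; by_adjacency.
Qed.

Lemma no_co_banner {G : sgraph} (a b c d e : G) :
  ~ contains_induced G co_banner ->
  ~~ [&& ~~ adj a b, ~~ adj b c, ~~ adj c d, ~~ adj d a, ~~ adj e a,
         adj a c, adj b d, adj e b, adj e c & adj e d].
Proof.
have := (adj_irr a, adj_irr b, adj_irr c, adj_irr d, adj_irr e).
move=> [[[[? ?] ?] ?] ?] nI.
apply/negP => adjs; apply: nI; move: adjs; intro_adjacencies.
exists (fun i : co_banner => nth a [:: a; b; c; d; e] i).
by split=> - [[|[|[|[|[|[]]]]]] //= ?] [[|[|[|[|[|[]]]]]] //= ?] //=;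
  by_adjacency.
Qed.

(** Outside [U] the nonneighbours of [v] are stable, so with [v] they form a clique of the
    complement; counting [v] saves the one in [k.+1]. *)
Lemma deg_compl_le_omega {G : sgraph} (v : G) (U : {set G}) (k : nat) :
  #|U| <= k.+1 ->
  {in ~: U &, forall x y, compl_adj v x -> compl_adj v y -> ~~ adj x y} ->
  @deg (compl G) v <= omega (compl G) + k.
Proof.
move=> leU stab; rewrite /deg -(cardsID U) addnC.
set S := _ :\: U; set T := _ :&: U.
have vS : v \notin S by rewrite !inE adj_irr andbF.
have clS : @clique (compl G) (v |: S).
  apply/forall_inP => x; rewrite !inE => xS; apply/forall_inP => y.
  rewrite !inE => yS; apply/implyP => xy.
  case/orP: xS yS xy => [/eqP-> |/andP[xU vx]].
    by case/orP=> [/eqP->|/andP[_]//]; rewrite eqxx.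
  case/orP=> [/eqP->|/andP[yU vy]] xy; first by rewrite adj_sym.
  by rewrite /= /compl_adj xy stab ?inE.
have leS : #|S|.+1 <= omega (compl G).
  have <- : #|v |: S| = #|S|.+1 by rewrite cardsU1 vS.
  exact: (leq_bigmax_cond (F := fun A : {set compl G} => #|A|)).
have leT : #|T| <= k.+1 by apply: leq_trans leU; apply/subset_leq_card/subsetIr.
by apply: leq_trans (leq_add (leqnn _) leT) _; rewrite addnS -addSn leq_add2r.
Qed.

Theorem theorem3p4 (G : sgraph) :
  ~ contains_induced G P2_P3 ->
  ~ contains_induced G (compl P2_P3) ->
  ~ contains_induced G K2_K3 ->
  ~ contains_induced G co_banner ->
  contains_induced G H2bar ->
  good (compl G).
Proof.
move=> nP nQ nK nB [f [f_inj fE]].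
pose ix i (lti : i < 6) : H2bar := Ordinal lti.
set v1 := ix 0 isT; set v2 := ix 1 isT; set v3 := ix 2 isT.
set v4 := ix 3 isT; set b1 := ix 4 isT; set b2 := ix 5 isT.
have neq i j : i != j -> f i != f j by rewrite (inj_eq f_inj).
(* The bound 1 on the sum encodes the four possible traces. *)
have trace x : compl_adj (f v2) x ->
  ~~ [&& adj (f v4) x, adj (f b1) x & adj (f b2) x] ->
  [&& ~~ adj (f v4) x, adj (f v1) x == adj (f v3) x &
      adj (f v1) x + adj (f b1) x + adj (f b2) x <= 1].
  move=> /andP[v2x v2Nx].
  move: (no_compl_P2_P3 (f v1) (f b2) (f v2) x (f b1) nQ (neq v1 b2 isT))
    (no_compl_P2_P3 (f v3) (f b1) (f v2) x (f b2) nQ (neq v3 b1 isT))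
    (no_compl_P2_P3 (f v2) x (f v1) (f v3) (f b1) nQ v2x)
    (no_K2_K3 (f v4) x (f v2) (f b1) (f b2) nK)
    (no_co_banner x (f v1) (f v3) (f b1) (f v2) nB)
    (no_co_banner x (f v3) (f v1) (f b2) (f v2) nB)
    (no_co_banner (f v4) (f b1) (f v3) x (f b2) nB)
    (no_co_banner (f v1) (f b2) (f v4) x (f v3) nB)
    (no_co_banner (f v4) (f v2) x (f b1) (f b2) nB)
    (no_co_banner (f v4) (f v2) x (f b2) (f b1) nB).
  rewrite !fE !(adj_sym x) (negbTE v2Nx) /=.
  by do 5!case: adj => //=.
pose U : {set G} := [set x in @nbh (compl G) (f v2) |
  [&& adj (f v4) x, adj (f b1) x & adj (f b2) x]].
right; right; left; exists (f v2); apply: (@deg_compl_le_omega G (f v2) U 2).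
  have trace1_inj : {in U &, injective (adj (f v1))}.
    move=> x y; rewrite !inE => /andP[/andP[_ /negbTE v2x] /and3P[v4x b1x b2x]].
    move=> /andP[/andP[_ /negbTE v2y] /and3P[v4y b1y b2y]] v1xy.
    apply/eqP/negPn/negP => xy.
    move: (no_compl_P2_P3 x y (f b1) (f v4) (f b2) nQ xy)
      (no_compl_P2_P3 (f v4) (f b1) x (f v1) y nQ (neq v4 b1 isT))
      (no_compl_P2_P3 (f v1) (f b2) x (f v2) y nQ (neq v1 b2 isT)).
    rewrite !fE !(adj_sym y) !(adj_sym x (f _)) -v1xy.
    rewrite v2x v2y v4x b1x b2x v4y b1y b2y /=.
    by do 2!case: adj => //=.
  rewrite -(card_in_imset trace1_inj).
  by apply: leq_trans (max_card _) _; rewrite card_bool.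
move=> x y; rewrite !inE /= => + + v2x v2y; rewrite v2x v2y.
move=> /(trace x v2x) + /(trace y v2y).
move: v2x v2y => /andP[_ /negbTE v2x] /andP[_ /negbTE v2y].
move: (no_P2_P3 x y (f v1) (f v2) (f v3) nP (neq v1 v3 isT))
  (no_K2_K3 x y (f v2) (f b1) (f b2) nK)
  (no_co_banner x (f v2) y (f b1) (f v1) nB)
  (no_co_banner x (f v2) y (f b1) (f b2) nB)
  (no_co_banner x (f v2) y (f b2) (f v3) nB)
  (no_co_banner x (f v2) y (f b2) (f b1) nB).
rewrite !fE !(adj_sym y) !(adj_sym x (f _)) v2x v2y.
case: (adj x y) => //=.
by do 5?[case: (adj (f _) x) => //=]; do 5?[case: (adj (f _) y) => //=].
Qed.
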